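(* Let $a,b$ be distinct positive integers and $X=\{a,b,a+b\}$. Then the nim sequence $\mathcal{G}_X$ of the all-but subtraction game with finite excluded subtraction set $X$ is purely arithmetic periodic: there exist integers $p\geq 1$ and $s\geq 0$ such that $\mathcal{G}_X(n+p)=\mathcal{G}_X(n)+s$ for all $n\geq 0$.
   Context: For a finite set $X$ of positive integers, the all-but subtraction game with finite excluded subtraction set $X$ is the subtraction game with subtraction set $S=\{1,2,3,\dots\}\setminus X$: a position is a heap of $n\geq 0$ counters, and a move removes $s$ counters for some $s\in S$ with $s\leq n$. Its nim sequence is defined by $\mathcal{G}_X(n)=\operatorname{mex}\{\mathcal{G}_X(n-s): s\in S,\ s\leq n\}$ for $n\geq 0$, where $\operatorname{mex}$ of a set of nonnegative integers is the least nonnegative integer not in it. *)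

(* Defs.v *)
From mathcomp Require Import all_boot.

Set Implicit Arguments.
Unset Strict Implicit.
Unset Printing Implicit Defensive.

Lemma ex_notin (s : seq nat) : exists m, m \notin s.
Proof.
exists (\max_(x <- s) x).+1; apply/negP=> sM.
by have := @leq_bigmax_seq _ s xpredT id _ sM isT; rewrite ltnn.
Qed.

Definition mex (s : seq nat) : nat := ex_minn (ex_notin s).

Definition subtraction_set := pred nat.

Definition all_but (X : seq nat) : subtraction_set :=
  [pred s | (0 < s) && (s \notin X)].

(* [v] gives the value of each heap smaller than [n]; removing 0 counters is
   never a move, whence the range 1..n for the number of counters removed. *)
Definition option_values (S : subtraction_set) (v : nat -> nat) (n : nat) :
    seq nat :=
  [seq v (n - s) | s <- iota 1 n & S s].

(* Course-of-values recursion: [nim_table S n] lists the nim values of the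
   heaps 0, ..., n - 1. The defining recurrence is [nim_seqE] below. *)
Fixpoint nim_table (S : subtraction_set) (n : nat) : seq nat :=
  if n is m.+1 then
    let t := nim_table S m in rcons t (mex (option_values S (nth 0 t) m))
  else [::].

Definition nim_seq (S : subtraction_set) (n : nat) : nat :=
  nth 0 (nim_table S n.+1) n.

Lemma size_nim_table S n : size (nim_table S n) = n.
Proof. by elim: n => //= n IHn; rewrite size_rcons IHn. Qed.

Lemma nth_nim_table S n i : i < n -> nth 0 (nim_table S n) i = nim_seq S i.
Proof.
elim: n => // n IHn; rewrite ltnS leq_eqVlt => /orP[/eqP-> // | lt_in].
by rewrite /= nth_rcons size_nim_table lt_in IHn.
Qed.

Lemma nim_seqE S n : nim_seq S n = mex (option_values S (nim_seq S) n).
Proof.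
rewrite {1}/nim_seq /= nth_rcons size_nim_table ltnn eqxx; congr mex.
apply/eq_in_map=> s; rewrite mem_filter mem_iota => /and3P[_ s_gt0 le_sn].
by apply: nth_nim_table; rewrite ltn_subrL s_gt0; case: n le_sn; case: s s_gt0.
Qed.

Lemma nim_seq_all_butE (X : seq nat) n :
  nim_seq (all_but X) n =
  mex [seq nim_seq (all_but X) (n - s) | s <- iota 1 n & s \notin X].
Proof.
rewrite nim_seqE /option_values; congr (mex (map _ _)).
by apply/eq_in_filter=> s; rewrite mem_iota /all_but /= => /andP[-> _].
Qed.

Definition purely_arithmetic_periodic (G : nat -> nat) : Prop :=
  exists p s : nat, 1 <= p /\ forall n : nat, G (n + p) = G n + s.

(* Main.v *)
Require Import Defs.
From mathcomp Require Import all_boot.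
From mathcomp Require Import zify.

Set Implicit Arguments.
Unset Strict Implicit.
Unset Printing Implicit Defensive.

(* Assume a < b and let x_k be the least heap of value at least k; it has value
   exactly k. Heaps of equal value differ by elements of X, so the heaps of
   value k lie among x_k, x_k + a, x_k + b and x_k + a + b. The heap x_k + b
   never has value less than k: otherwise x_k - a = x_g for some g < k, but then
   the heap x_k = x_g + a would have value at most g. It follows that
   the heaps of value k can be recovered from the set U_{k+1} of heaps of value
   at most k: its largest element is x_k + a + b, and whether x_k + a or x_k + b
   has value k is read off from whether x_k + b is in U_{k+1} (if b = 2a, both
   have value k). Hence the shape
   of U_{k+1}, that is its translate by -x_{k+1}, determines the shape of U_k.
   There are finitely many shapes, so two of them agree, and stepping backwards
   the empty shape of U_0 recurs as that of some U_d with d > 0. From then on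
   the sequence starts afresh, shifted by x_d and raised by d. *)

Lemma mex_notin (s : seq nat) : mex s \notin s.
Proof. by rewrite /mex; case: ex_minnP. Qed.

Lemma mem_lt_mex (s : seq nat) g : g < mex s -> g \in s.
Proof.
rewrite /mex; case: ex_minnP => m _ min_m lt_gm; apply/negPn/negP => /min_m.
by rewrite leqNgt lt_gm.
Qed.

Lemma nim_seq_eq_excluded (X : seq nat) m n :
  m < n -> nim_seq (all_but X) m = nim_seq (all_but X) n -> n - m \in X.
Proof.
move=> lt_mn eG; apply/negPn/negP => nX.
have := mex_notin [seq nim_seq (all_but X) (n - s) | s <- iota 1 n & s \notin X].
rewrite -nim_seq_all_butE -eG => /mapP; apply; exists (n - m).
  by rewrite mem_filter nX mem_iota; lia.
by rewrite subKn // ltnW.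
Qed.

Lemma nim_seq_option (X : seq nat) n g :
  g < nim_seq (all_but X) n ->
  exists m, [/\ m < n, nim_seq (all_but X) m = g & n - m \notin X].
Proof.
rewrite nim_seq_all_butE => /mem_lt_mex/mapP[s].
rewrite mem_filter mem_iota => /and3P[nX s_gt0 le_sn] ->.
by exists (n - s); split; [lia | by [] | rewrite subKn //; lia].
Qed.

Section Excluded.

Variables a b : nat.
Hypotheses (a_gt0 : 0 < a) (lt_ab : a < b).

Local Notation ab_excluded d := ([\/ d = a, d = b | d = a + b]).

Variable G : nat -> nat.
Hypothesis G_eq : forall m n, m < n -> G m = G n -> ab_excluded (n - m).
Hypothesis G_option : forall n g, g < G n ->
  exists m, [/\ m < n, G m = g & ~ ab_excluded (n - m)].

(** Were [G n <= G m], then [m] or one of its options would have value [G n] at a distance over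
    [a + b] from [n]. *)
Lemma G_far m n : m + (a + b) < n -> G m < G n.
Proof.
move=> far; rewrite ltnNge; apply/negP; rewrite leq_eqVlt => /orP[/eqP eG|lt].
  have /G_eq : m < n by lia.
  by move/(_ (esym eG)) => []; lia.
have [p [lt_pm eG _]] := G_option lt.
have /G_eq : p < n by lia.
by move/(_ eG) => []; lia.
Qed.

Lemma G_unbounded k : exists n, k <= G n.
Proof.
elim: k => [|k [n le_kn]]; first by exists 0.
by exists (n + (a + b)).+1; apply: leq_ltn_trans le_kn (G_far _).
Qed.

Definition first k := ex_minn (G_unbounded k).

Lemma first_min k n : k <= G n -> first k <= n.
Proof. by rewrite /first; case: ex_minnP => m _; apply. Qed.

Lemma G_first k : G (first k) = k.
Proof.
apply/eqP; rewrite eqn_leq andbC.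
have le_k : k <= G (first k) by rewrite /first; case: ex_minnP.
rewrite le_k leqNgt; apply/negP => /G_option[m [lt_m eG _]].
by have := @first_min k m; rewrite eG leqnn => /(_ isT); lia.
Qed.

Lemma first_mono g k : g < k -> first g < first k.
Proof.
move=> lt_gk; rewrite ltn_neqAle first_min ?G_first 1?ltnW // andbT.
by apply: contraTneq lt_gk => e; rewrite -[g]G_first e G_first ltnn.
Qed.

Lemma class_shape k n : G n = k ->
  exists2 d, n = first k + d & d = 0 \/ ab_excluded d.
Proof.
move=> eG; have : first k <= n by apply: first_min; rewrite eG.
rewrite leq_eqVlt => /orP[/eqP<-|lt]; first by exists 0; [rewrite addn0 | left].
exists (n - first k); first by lia.
by right; apply: G_eq => //; rewrite G_first.
Qed.

Lemma G_first_far k n : first k + (a + b) <= n -> k <= G n.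
Proof.
move=> le_n; rewrite leqNgt; apply/negP => lt.
have := first_mono lt.
by have [d ed [|[]]] := class_shape (erefl (G n)) => e; lia.
Qed.

(** An option of value [k] would be [first k + d] with [d] among 0, [a], [b], and reaching it takes
    an excluded move. *)
Lemma G_first_ab k : G (first k + (a + b)) = k.
Proof.
apply/eqP; rewrite eqn_leq G_first_far // andbT leqNgt; apply/negP.
move=> /G_option[m [lt_m /class_shape[d em [d0|e]]]]; rewrite {}em in lt_m *;
  apply; first by constructor 3; lia.
rewrite subnDl; case: e => e; [constructor 2 | constructor 1 | exfalso]; lia.
Qed.

Lemma G_first_a_le k : G (first k + a) <= k.
Proof.
rewrite leqNgt; apply/negP => /G_option[m [lt_m /class_shape[d em [|e]]]].
  by move=> d0 []; constructor 1; lia.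
by case: e; lia.
Qed.

Lemma G_first_b_ge k : k <= G (first k + b).
Proof.
rewrite leqNgt; apply/negP => lt; have lt_first := first_mono lt.
have [d ed [|[]]] := class_shape (erefl (G (first k + b))) => e; try lia.
have := G_first_a_le (G (first k + b)).
have -> : first (G (first k + b)) + a = first k by lia.
by rewrite G_first; lia.
Qed.

Lemma G_first_b_gt k :
  k < G (first k + b) -> G (first k + a) = k /\ b <> a.*2.
Proof.
move=> /G_option[m [lt_m eG nX]].
have [d em [|[]]] := class_shape eG => e; try lia.
  by case: nX; constructor 2; lia.
split; first by rewrite -e -em.
by move=> e2; case: nX; constructor 1; lia.
Qed.

Lemma G_first_a_double k : b = a.*2 -> G (first k + a) = k.
Proof.
move=> e2; apply/eqP; rewrite eqn_leq G_first_a_le leqNgt; apply/negP => lt.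
have lt_first := first_mono lt.
have [d ed [|[]]] := class_shape (erefl (G (first k + a))) => e; try lia.
  have := G_first_a_le (G (first k + a)).
  have -> : first (G (first k + a)) + a = first k by lia.
  by rewrite G_first; lia.
(* Here [first k = first g + b] for the smaller value [g], which [G_first_b_gt] rules out when
   [b = a.*2]. *)
have := @G_first_b_gt (G (first k + a)).
have -> : first (G (first k + a)) + b = first k by lia.
by rewrite G_first => /(_ lt)[].
Qed.

(* The right-hand side refers to values only through the set of heaps of value
   at most k. *)
Lemma class_from_cover k n : G (first k + n) = k <->
  [\/ n = 0, n = a + b, n = b /\ G (first k + b) <= k |
      n = a /\ (b = a.*2 \/ ~ G (first k + b) <= k)].
Proof.
split=> [eG|].
  have [d /addnI <- [|[]]] := class_shape eG => e; subst n.
  - by constructor 1.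
  - constructor 4; split=> //.
    have [le|] := leqP (G (first k + b)) k; last by right; lia.
    left; have eb : G (first k + b) = k by have := G_first_b_ge k; lia.
    have /G_eq : first k + a < first k + b by lia.
    by rewrite eG eb => /(_ erefl)[]; lia.
  - by constructor 3; rewrite eG.
  - by constructor 2.
case=> [->|->|[-> le]|[-> [e2|gt]]].
- by rewrite addn0 G_first.
- exact: G_first_ab.
- by have := G_first_b_ge k; lia.
- exact: G_first_a_double.
- by apply: (@G_first_b_gt k _).1; lia.
Qed.

(** Heaps before [first i] all have value less than [i], so only later ones are compared. *)
Definition same_shape i j :=
  forall n, (G (first i + n) < i) = (G (first j + n) < j).

Lemma same_shape_sym i j : same_shape i j -> same_shape j i.
Proof. by move=> sij n. Qed.

Lemma first_gap_le k : first k.+1 <= (first k + (a + b)).+1.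
Proof. by apply: first_min; rewrite -[X in X < _](G_first k) G_far. Qed.

Lemma cover_max k n : G n <= k -> n <= first k + (a + b).
Proof.
by move=> le; rewrite leqNgt; apply/negP => /G_far; rewrite G_first; lia.
Qed.

(** The last heap of value at most [i] is [first i + (a + b)]. If it lies before [first i.+1], the
    gap after [first i] is maximal; otherwise its translate is a heap of value at most [j]. *)
Lemma same_shape_gap_le i j : same_shape i.+1 j.+1 ->
  first j.+1 + first i <= first i.+1 + first j.
Proof.
move=> sij; have := first_gap_le j.
have [lt|le] := ltnP (first i + (a + b)) (first i.+1); first by lia.
have := sij (first i + (a + b) - first i.+1).
rewrite subnKC // G_first_ab !ltnS leqnn => /esym/cover_max; lia.
Qed.

Lemma same_shape_pred i j : same_shape i.+1 j.+1 -> same_shape i j.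
Proof.
move=> sij.
have gap : first j.+1 + first i = first i.+1 + first j.
  apply/eqP; rewrite eqn_leq same_shape_gap_le //=.
  by have := same_shape_gap_le (same_shape_sym sij); lia.
have cover n : (G (first i + n) <= i) = (G (first j + n) <= j).
  (* Before the next first heap both sides are true. *)
  have [lt|le] := ltnP (first i + n) (first i.+1).
    have lt' : first j + n < first j.+1 by lia.
    transitivity true; [|symmetry]; rewrite -ltnS ltnNge; apply/negP;
      by move/first_min; lia.
  have := sij (first i + n - first i.+1); rewrite subnKC // !ltnS => ->.
  by have -> : first j.+1 + (first i + n - first i.+1) = first j + n by lia.
have class n : G (first i + n) = i <-> G (first j + n) = j.
  rewrite !class_from_cover; split; rewrite cover; exact.
move=> n; rewrite !ltn_neqAle cover; congr andb; congr negb.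
by apply/eqP/eqP => /class.
Qed.

(** Pigeonhole: by [G_first_far], a shape is determined by its first [a + b] entries. *)
Lemma same_shape_recurs : exists i j, i < j /\ same_shape i j.
Proof.
pose shape k : {ffun 'I_(a + b) -> bool} := [ffun n => G (first k + val n) < k].
pose N := #|{ffun 'I_(a + b) -> bool}|.
have /injectivePn[i [j ne eij]] : ~~ injectiveb (fun k : 'I_N.+1 => shape k).
  by apply/injectiveP => /leq_card; rewrite card_ord ltnn.
have sij : same_shape i j.
  move=> n; have [lt|le] := ltnP n (a + b).
    by have /ffunP/(_ (Ordinal lt)) := eij; rewrite !ffunE.
  by rewrite !ltnNge !G_first_far ?leq_add2l.
have [lt|lt|/val_inj e] := ltngtP i j; last by rewrite e eqxx in ne.
  by exists i, j.
by exists j, i; split=> //; apply: same_shape_sym.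
Qed.

Lemma G_restarts : exists2 d, 0 < d & forall n, d <= G (first d + n).
Proof.
have [i [j [lt_ij sij]]] := same_shape_recurs.
exists (j - i); first by rewrite subn_gt0.
have : same_shape 0 (j - i).
  elim: i j lt_ij sij => [|i IHi] [|j] //.
  by move=> lt_ij /same_shape_pred; apply: IHi.
by move=> s n; rewrite leqNgt -s.
Qed.

Lemma G_purely_periodic : purely_arithmetic_periodic G.
Proof.
have [d d_gt0 restart] := G_restarts.
exists (first d), d; split.
  by have := first_mono d_gt0; lia.
move=> n; rewrite addnC; elim/ltn_ind: n => n IHn.
apply/eqP; rewrite eqn_leq; apply/andP; split; rewrite leqNgt; apply/negP => lt.
  (* An option of value [G n + d] lies at or after [first d], so by induction it is the translate of
     a heap of value [G n]. *)
  have [m [lt_m eG nX]] := G_option lt.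
  have [lt_mp|le_pm] := ltnP m (first d).
    have : G m < d by rewrite ltnNge; apply/negP => /first_min; lia.
    lia.
  have lt' : m - first d < n by lia.
  have := IHn _ lt'; rewrite subnKC // eG => /addIn/esym/(G_eq lt').
  by rewrite -(_ : first d + n - m = n - (m - first d)) //; lia.
have [m [lt_m eG nX]] : exists m, [/\ m < n, G m = G (first d + n) - d
    & ~ ab_excluded (n - m)].
  by apply: G_option; have := restart n; lia.
have /G_eq : first d + m < first d + n by lia.
by rewrite IHn // eG subnK // subnDl => /(_ erefl).
Qed.

End Excluded.

Theorem mainTheorem4 (a b : nat) (a_gt0 : 0 < a) (b_gt0 : 0 < b)
    (a_neq_b : a <> b) :
  purely_arithmetic_periodic (nim_seq (all_but [:: a; b; a + b])).
Proof.
set X := [:: a; b; a + b].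
have memX d : d \in X <-> [\/ d = a, d = b | d = a + b].
  rewrite !inE; split=> [/or3P[]/eqP-> | [] ->]; rewrite ?eqxx ?orbT //.
  - by constructor 1.
  - by constructor 2.
  - by constructor 3.
(* For the case [b < a], with the two roles exchanged. *)
have memXC d : d \in X <-> [\/ d = b, d = a | d = b + a].
  rewrite memX addnC; split=> -[] ->;
    by [constructor 2 | constructor 1 | constructor 3].
have [lt|lt|//] := ltngtP a b.
  apply: (G_purely_periodic a_gt0 lt) => [m n lt_mn e|n g /nim_seq_option].
    exact/memX/nim_seq_eq_excluded.
  by case=> m [lt_mn e /negP nX]; exists m; split=> // /memX.
apply: (G_purely_periodic b_gt0 lt) => [m n lt_mn e|n g /nim_seq_option].
  exact/memXC/nim_seq_eq_excluded.
by case=> m [lt_mn e /negP nX]; exists m; split=> // /memXC.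
Qed.
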